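(* If $G$ is a connected triangle-free graph of order $n\ge 2$, then $$\chi_{\mu_i}(G)\le \left\lceil \frac{n-\mu_i(G)}{2}\right\rceil+1.$$ Moreover, this bound is sharp: there exist connected triangle-free graphs attaining equality.
   Context: All graphs are finite and simple. A geodesic is a shortest path. For $X\subseteq V(G)$, two vertices $x,y\in X$ are $X$-visible if some $x,y$-geodesic has no internal vertex in $X$. $X$ is an independent mutual-visibility (IMV) set if $X$ is independent and every two vertices of $X$ are $X$-visible. $\mu_i(G)$ is the maximum cardinality of an IMV set of $G$. $\chi_{\mu_i}(G)$ is the least $k$ such that $V(G)$ can be partitioned into $k$ IMV sets (equivalently, the least $k$ for which there is a map $c:V(G)\to[k]$ all of whose color classes are IMV sets). *)

(* Defs.v *)
From mathcomp Require Import all_boot.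

Set Implicit Arguments.
Unset Strict Implicit.
Unset Printing Implicit Defensive.

Record sgraph := SGraph {
  vertex :> finType;
  adj : rel vertex;
  adj_sym : symmetric adj;
  adj_irr : irreflexive adj }.

Section Graph.
Variable G : sgraph.
Implicit Types (x y z : G) (p : seq G) (X : {set G}).

Definition connected : bool := [forall x : G, forall y : G, connect (@adj G) x y].

Definition triangle_free : bool :=
  [forall x : G, forall y : G, forall z : G, ~~ [&& adj x y, adj y z & adj z x]].

(* The path x = v_0, v_1, ..., v_k = y is given by x and p = [:: v_1; ...; v_k],
   so that its length is size p. *)
Definition xy_path x y p : bool :=
  [&& path (@adj G) x p, last x p == y & uniq (x :: p)].

Definition geodesic x y p : bool :=
  xy_path x y p &&
  [forall k : 'I_(size p), forall q : k.-tuple G, ~~ xy_path x y q].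

Definition internal x p : seq G := behead (belast x p).

(* A path of G has fewer than #|G| edges, so the bound on k loses nothing;
   see visibleP. *)
Definition visible X x y : bool :=
  [exists k : 'I_#|G|, exists p : k.-tuple G,
    geodesic x y p && all (fun z => z \notin X) (internal x p)].

Definition independent X : bool := [forall x in X, forall y in X, ~~ adj x y].

Definition imv X : bool :=
  independent X && [forall x in X, forall y in X, (x != y) ==> visible X x y].

Definition mu_i : nat := \max_(X : {set G} | imv X) #|X|.

Lemma mu_i_le_order : mu_i <= #|G|.
Proof. by apply/bigmax_leqP => X _; apply: max_card. Qed.

Definition imv_partitionable (k : nat) : bool :=
  [exists P : {set {set G}},
    [&& partition P [set: G], #|P| == k & [forall X in P, imv X]]].

Lemma geodesicP x y p :
  reflect (xy_path x y p /\ forall q, xy_path x y q -> size p <= size q)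
          (geodesic x y p).
Proof.
apply: (iffP andP) => -[xp min_p]; split=> //.
  move=> q xq; rewrite leqNgt; apply/negP => lt_qp.
  move/forallP/(_ (Ordinal lt_qp))/forallP/(_ (in_tuple q)): min_p.
  by rewrite /= xq.
apply/forallP => k; apply/forallP => q; apply/negP => /min_p.
by rewrite size_tuple leqNgt ltn_ord.
Qed.

Lemma visibleP X x y :
  reflect (exists2 p, geodesic x y p & {in internal x p, forall z, z \notin X})
          (visible X x y).
Proof.
apply: (iffP existsP) => [[k /existsP[p /andP[gp /allP Xp]]]|[p gp Xp]].
  by exists p.
have lt_p : size p < #|G|.
  case/geodesicP: (gp) => /and3P[_ _ /card_uniqP eq_p] _.
  by have := max_card [in x :: p]; rewrite eq_p.
exists (Ordinal lt_p); apply/existsP; exists (in_tuple p).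
by rewrite gp /=; apply/allP.
Qed.

Lemma imv_set1 x : imv [set x].
Proof.
apply/andP; split; apply/forall_inP => y /set1P->;
  by apply/forall_inP => z /set1P->; rewrite ?eqxx // adj_irr.
Qed.

Lemma imv_partitionable_ex : exists k, imv_partitionable k.
Proof.
pose P : {set {set G}} := [set [set x] | x in G].
exists #|P|; apply/existsP; exists P; rewrite eqxx /=; apply/andP; split.
  apply/and3P; split.
  - rewrite eqEsubset subsetT; apply/subsetP => x _.
    by apply/bigcupP; exists [set x]; rewrite ?set11 // imset_f.
  - apply/trivIsetP => _ _ /imsetP[x _ ->] /imsetP[y _ ->] neq_xy.
    by rewrite disjoints1 inE; apply: contraNN neq_xy => /eqP->.
  - by apply/imsetP => -[x _ /setP/(_ x)]; rewrite !inE eqxx.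
by apply/forall_inP => _ /imsetP[x _ ->]; apply: imv_set1.
Qed.

Definition chi_mu_i : nat := ex_minn imv_partitionable_ex.

End Graph.

(* Main.v *)
Require Import Defs.
From mathcomp Require Import all_boot.

(** In a connected triangle-free graph, two non-adjacent vertices form an IMV
    set, and so does every open neighbourhood [N(v)], whose vertices see each
    other through [v].  Peeling off pairs of non-adjacent vertices covers any
    vertex set [R] by [uphalf #|R|] IMV sets, unless [R] is an edge: the only
    obstruction arises at four vertices with no two disjoint non-adjacent pairs,
    and these form a star.  Apply this to the complement [R] of a maximum IMV
    set; if [R] is an edge [uv], then [N(u)] and [N(v)] cover the graph.
    Equality holds for the complete graph on two vertices. *)

Set Implicit Arguments.
Unset Strict Implicit.
Unset Printing Implicit Defensive.

(** * Basic IMV sets: subsets, non-adjacent pairs, open neighbourhoods *)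

Section IMVSets.
Variable G : sgraph.
Implicit Types (x y z u v : G) (X Y R : {set G}) (s : seq {set G}).

Definition neighbours v : {set G} := [set w | adj v w].

Lemma imvP X :
  reflect ({in X &, forall x y, ~~ adj x y} /\
           {in X &, forall x y, x != y -> visible X x y})
          (imv X).
Proof.
apply: (iffP andP) => -[indX visX]; split.
- by move=> x y Xx Xy; apply: (forall_inP (forall_inP indX x Xx)).
- by move=> x y Xx Xy; apply/implyP; apply: (forall_inP (forall_inP visX x Xx)).
- by apply/forall_inP => x Xx; apply/forall_inP => y; apply: indX.
- apply/forall_inP => x Xx; apply/forall_inP => y Xy.
  by apply/implyP; apply: visX.
Qed.

(** A geodesic whose interior avoids [X] also avoids every subset of [X]. This heredity is what lets
    overlapping covers be trimmed to partitions. *)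
Lemma imvS X Y : Y \subset X -> imv X -> imv Y.
Proof.
move=> /subsetP sYX /imvP[indX visX]; apply/imvP; split=> x y Yx Yy.
  by apply: indX; apply: sYX.
move=> /(visX x y (sYX _ Yx) (sYX _ Yy))/visibleP[p gp Xp].
apply/visibleP; exists p => // z pz.
by apply: contra (Xp z pz); apply: sYX.
Qed.

Lemma connect_geodesic x y :
  connect (@adj G) x y -> exists p, geodesic x y p.
Proof.
case/connectP => p xp ->; case/shortenP: xp => q xq uq _.
(* Fixing the length makes the existence of a path decidable, so a least length can be extracted. *)
have exP : exists k, [exists q' : k.-tuple G, xy_path x (last x q) q'].
  by exists (size q); apply/existsP; exists (in_tuple q);
    rewrite /xy_path xq eqxx.
case: (ex_minnP exP) => k /existsP[r xr] min_k.
exists r; apply/geodesicP; split=> // q' xq'; rewrite size_tuple.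
by apply: min_k; apply/existsP; exists (in_tuple q').
Qed.

Lemma internal_neq_ends x y p z :
  xy_path x y p -> z \in internal x p -> (z != x) && (z != y).
Proof.
case: p => [|a p] // /and3P[_ /eqP lasty].
rewrite cons_uniq lastI mem_rcons rcons_uniq inE negb_or /internal belast_rcons /=.
case/andP => /andP[_ xnp] /andP[lnp _] zp.
rewrite -lasty /=; apply/andP.
by split; [apply: contraNneq xnp | apply: contraNneq lnp] => <-.
Qed.

(** Connectedness supplies a geodesic between the two vertices, and its interior misses its own
    ends, hence the whole set. *)
Lemma imv_set2 x y : connected G -> ~~ adj x y -> imv [set x; y].
Proof.
move=> cG nxy; apply/imvP; split=> a b.
  by rewrite !inE => /orP[]/eqP-> /orP[]/eqP->; rewrite ?adj_irr // adj_sym.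
move=> Xa Xb nab.
have [p gp] := connect_geodesic (forallP (forallP cG a) b).
apply/visibleP; exists p => // z pz.
case/geodesicP: gp => /internal_neq_ends/(_ pz)/andP[nza nzb] _.
move: Xa Xb nza nzb nab; rewrite !inE negb_or.
by do 2![case/orP => /eqP->]; rewrite ?eqxx // => -> ->.
Qed.

Lemma triangle_freeP x y z :
  triangle_free G -> adj x y -> adj y z -> ~~ adj x z.
Proof.
move=> tfG xy yz; have := forallP (forallP (forallP tfG x) y) z.
by rewrite xy yz /= adj_sym.
Qed.

Lemma imv_neighbours v : triangle_free G -> imv (neighbours v).
Proof.
move=> tfG; apply/imvP; split=> x y; rewrite !inE => vx vy.
  by apply: triangle_freeP vy; rewrite // adj_sym.
have nxy : ~~ adj x y by apply: triangle_freeP vy; rewrite // adj_sym.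
move=> neq_xy; apply/visibleP; exists [:: v; y]; last first.
  by move=> z; rewrite inE => /eqP->; rewrite inE adj_irr.
apply/geodesicP; split.
  rewrite /xy_path /= (adj_sym x) vx vy eqxx !inE negb_or neq_xy /= !andbT.
  by apply/andP; split; [apply: contraTneq vx | apply: contraTneq vy] => ->;
    rewrite adj_irr.
(* A path shorter than two edges would make [x] and [y] equal or adjacent. *)
case=> [|a [|b q]] // /and3P[/= ].
  by move=> _ /eqP exy; rewrite exy eqxx in neq_xy.
by rewrite andbT => xa /eqP exa; rewrite exa (negPf nxy) in xa.
Qed.

(** * From covers by possibly overlapping IMV sets to partitions *)

Definition imv_cover s R : bool :=
  all (@imv G) s && (R \subset \bigcup_(X <- s) X).

Lemma imv_cover_cons s X R :
  imv X -> imv_cover s (R :\: X) -> imv_cover (X :: s) R.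
Proof.
move=> imvX /andP[imvs sRs]; rewrite /imv_cover /= imvX imvs /= big_cons.
by rewrite -subDset.
Qed.

Lemma imv_cover2 X Y R :
  imv X -> imv Y -> R \subset X :|: Y -> imv_cover [:: X; Y] R.
Proof.
by move=> iX iY sR; rewrite /imv_cover /= iX iY /= big_cons big_seq1.
Qed.

(** Each set is replaced by its difference with the union of the later ones. Empty differences are
    dropped, since blocks are nonempty, so the size is only bounded. *)
Lemma imv_partition_of_cover s :
  all (@imv G) s ->
  exists P : {set {set G}},
    [/\ partition P (\bigcup_(X <- s) X), #|P| <= size s &
        {in P, forall X, imv X}].
Proof.
elim: s => [_|X s IHs /= /andP[imvX /IHs[P [partP leP imvP']]]].
  exists set0; rewrite big_nil partition_set0 eqxx cards0.
  by split=> // X; rewrite inE.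
rewrite big_cons; set D := \bigcup_(Y <- s) Y in partP *.
have eqD : (X :\: D) :|: D = X :|: D.
  by apply/setP => z; rewrite !inE; case: (z \in D); rewrite ?orbT ?orbF.
have [X0|X_neq0] := eqVneq (X :\: D) set0.
  by exists P; rewrite -eqD X0 set0U; split=> //; apply: leqW.
exists ((X :\: D) |: P); rewrite -eqD; split.
- apply: partitionU1 => //; rewrite -setI_eq0.
  by apply/eqP/setP => z; rewrite !inE; case: (z \in D); rewrite ?andbF.
- by rewrite cardsU1; apply: (@leq_add _ _ 1 (size s)) => //; apply: leq_b1.
- move=> Y /setU1P[->|]; last exact: imvP'.
  exact: imvS (subsetDl _ _) imvX.
Qed.

Lemma chi_mu_i_le_cover s : imv_cover s [set: G] -> chi_mu_i G <= size s.
Proof.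
case/andP => /imv_partition_of_cover[P [partP leP imvP']].
rewrite subTset => /eqP covT; apply: leq_trans leP.
rewrite /chi_mu_i; case: ex_minnP => k _; apply.
apply/existsP; exists P; rewrite -covT partP eqxx /=.
exact/forall_inP.
Qed.

(** Every class of an optimal partition has at most [mu_i G] vertices. This gives the lower bound in
    the sharpness example. *)
Lemma order_le_chi_mu_i : #|G| <= chi_mu_i G * mu_i G.
Proof.
rewrite /chi_mu_i; case: ex_minnP => k /existsP[P].
case/and3P => partP /eqP<- /forall_inP imvP' _.
rewrite -cardsT (card_partition partP) -sum_nat_const.
by apply: leq_sum => X /imvP' imvX; apply: (leq_bigmax_cond X imvX).
Qed.

(** * Covering a vertex set by half as many IMV sets *)

Lemma nonadj_pair R :
  triangle_free G -> 2 < #|R| ->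
  exists x y, [/\ x \in R, y \in R, x != y & ~~ adj x y].
Proof.
move=> tfG /card_gt2P[x [y [z [[Rx Ry Rz] [xy yz zx]]]]].
have [axy|] := boolP (adj x y); last by exists x, y.
have [ayz|] := boolP (adj y z); last by exists y, z.
by exists x, z; rewrite eq_sym zx; split=> //; apply: triangle_freeP ayz.
Qed.

(** As [c d] is an edge, [a] and [b] each have at most one neighbour in it. If both have the same
    one, the four vertices form a star, covered by its centre and the centre's neighbourhood.
    Otherwise they split into two non-adjacent pairs. *)
Lemma imv_cover4 a b c d :
  connected G -> triangle_free G -> ~~ adj a b -> adj c d ->
  exists2 s, size s = 2 & imv_cover s [set a; b; c; d].
Proof.
move=> cG tfG nab cd.
have pairs x y z t : ~~ adj x y -> ~~ adj z t ->
    [set a; b; c; d] \subset [set x; y] :|: [set z; t] ->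
    exists2 s, size s = 2 & imv_cover s [set a; b; c; d].
  move=> nxy nzt sub; exists [:: [set x; y]; [set z; t]] => //.
  by apply: imv_cover2 => //; apply: imv_set2.
have star v : [set a; b; c; d] \subset neighbours v :|: [set v] ->
    exists2 s, size s = 2 & imv_cover s [set a; b; c; d].
  move=> sub; exists [:: neighbours v; [set v]] => //.
  by apply: imv_cover2; rewrite ?imv_set1 ?imv_neighbours.
have subP X : a \in X -> b \in X -> c \in X -> d \in X ->
    [set a; b; c; d] \subset X.
  by move=> Xa Xb Xc Xd; rewrite !subUset !sub1set Xa Xb Xc.
have [ac|nac] := boolP (adj a c).
  have nad : ~~ adj a d by apply: triangle_freeP cd.
  have [bc|nbc] := boolP (adj b c).
    by apply: (star c); apply: subP;
      rewrite !inE ?(eqxx, orbT, cd) // adj_sym ?(ac, bc).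
  by apply: (pairs a d b c) => //; apply: subP; rewrite !inE eqxx ?orbT.
have [bd|nbd] := boolP (adj b d); last first.
  by apply: (pairs a c b d) => //; apply: subP; rewrite !inE eqxx ?orbT.
have nbc : ~~ adj b c by apply: triangle_freeP bd _; rewrite // adj_sym.
have [ad|nad] := boolP (adj a d).
  by apply: (star d); apply: subP;
    rewrite !inE ?(eqxx, orbT, cd) // adj_sym ?(ad, bd, cd).
by apply: (pairs a d b c) => //; apply: subP; rewrite !inE eqxx ?orbT.
Qed.

Lemma imv_half_cover R :
  connected G -> triangle_free G ->
  (exists u v, adj u v /\ R = [set u; v]) \/
  (exists2 s, size s <= uphalf #|R| & imv_cover s R).
Proof.
move=> cG tfG; have [n] := ubnP #|R|; elim: n R => // n IHn R /ltnSE leR.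
case: (ltngtP #|R| 2) => cardR; last 1 first.
- have /cards2P[u [v [_ ->]]] : #|R| == 2 by apply/eqP.
  have [uv|nuv] := boolP (adj u v); first by left; exists u, v.
  right; exists [:: [set u; v]]; first by rewrite cards2; case: (u != v).
  by rewrite /imv_cover /= imv_set2 //= big_seq1.
- right; case: (set_0Vmem R) => [->|[x Rx]].
    by exists [::]; rewrite // /imv_cover sub0set.
  have eqR : R = [set x].
    by apply/esym/eqP; rewrite eqEcard sub1set Rx cards1.
  by exists [:: R]; rewrite eqR ?cards1 // /imv_cover /= imv_set1 big_seq1 /=.
have [x [y [Rx Ry neq_xy nxy]]] := nonadj_pair tfG cardR.
have sub : [set x; y] \subset R by rewrite subUset !sub1set Rx.
have cardRxy : #|R| = (#|R :\: [set x; y]|).+2.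
  by rewrite -(cardsID [set x; y] R) (setIidPr sub) cards2 neq_xy.
right; have [|[u [v [uv eqR]]]|[s les covs]] := IHn (R :\: [set x; y]).
- by rewrite cardRxy in leR; apply: ltnW.
(* What remains is an edge, so the pair just removed is put back and the four vertices are covered
   together by two sets. *)
- have eqR4 : R = [set x; y; u; v].
    by rewrite -(setID R [set x; y]) (setIidPr sub) eqR setUA.
  have [s sz covs] := imv_cover4 cG tfG nxy uv.
  exists s; last by rewrite eqR4.
  rewrite sz cardRxy eqR cards2; suff -> : u != v by [].
  by apply: contraTneq uv => ->; rewrite adj_irr.
- exists ([set x; y] :: s); first by rewrite cardRxy.
  by apply: imv_cover_cons => //; apply: imv_set2.
Qed.

(** * The upper bound *)

Lemma connected_neighbour x :
  connected G -> 1 < #|G| -> exists y, adj x y.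
Proof.
move=> cG /card_gt1P[a [b [_ _ nab]]].
have [z nxz] : exists z, x != z.
  by have [->|] := eqVneq x a; [exists b | exists a].
case/connectP: (forallP (forallP cG x) z) nxz => -[|y p] /=.
  by move=> _ ->; rewrite eqxx.
by case/andP => xy _ _ _; exists y.
Qed.

(** The empty set is IMV, so the maximum is over a nonempty family and is attained. *)
Lemma mu_i_witness : exists2 X : {set G}, imv X & #|X| = mu_i G.
Proof.
have imv0 : set0 \in @imv G by rewrite unfold_in; apply/imvP; split=> x y; rewrite inE.
by have [X imvX eqX] := @eq_bigmax_cond _ (@imv G) (fun X => #|X|)
  (introT card_gt0P (ex_intro _ set0 imv0)); exists X.
Qed.

Lemma chi_mu_i_upper :
  connected G -> triangle_free G -> 1 < #|G| ->
  chi_mu_i G <= uphalf (#|G| - mu_i G) + 1.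
Proof.
move=> cG tfG ntG; have [S imvS' cardS] := mu_i_witness.
have eqC : #|G| - mu_i G = #|~: S| by rewrite cardsCs setCK cardS.
rewrite eqC.
case: (imv_half_cover (~: S) cG tfG) => [[u [v [uv eqR]]]|[s les covs]].
- have cardR : #|~: S| = 2.
    rewrite eqR cards2; suff -> : u != v by [].
    by apply: contraTneq uv => ->; rewrite adj_irr.
  (* The bound is now 2, so [S] cannot be spent as a separate set. Each vertex of [S] has a
     neighbour, which independence of [S] forces to be [u] or [v]; and [u], [v] are neighbours of
     each other. *)
  rewrite cardR; apply: (@chi_mu_i_le_cover [:: neighbours u; neighbours v]).
  apply: imv_cover2; rewrite ?imv_neighbours //.
  apply/subsetP => w _; have [Sw|] := boolP (w \in S); last first.
    rewrite -in_setC eqR !inE => /orP[]/eqP->; last by rewrite uv.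
    by rewrite adj_sym uv orbT.
  have [y wy] := connected_neighbour w cG ntG.
  have : y \in ~: S.
    rewrite inE; apply: contraTN wy => Sy.
    by case/imvP: imvS' => indS _; apply: indS.
  by rewrite eqR !inE => /orP[]/eqP<-; rewrite (adj_sym y) wy ?orbT.
(* The summand 1 pays for [S] itself. *)
- rewrite addn1; apply: leq_trans (_ : size (S :: s) <= _) => //.
  by apply: chi_mu_i_le_cover; apply: imv_cover_cons; rewrite // setTD.
Qed.

End IMVSets.

(** * Sharpness on the complete graph with two vertices *)

Definition K2 : sgraph.
Proof.
refine (@SGraph bool (fun x y => x != y) _ _) => [x y|x]; first by rewrite eq_sym.
by rewrite eqxx.
Defined.

Lemma K2_connected : connected K2.
Proof.
apply/forallP => x; apply/forallP => y.
by have [->|nxy] := eqVneq x y; [apply: connect0 | apply: connect1].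
Qed.

Lemma K2_triangle_free : triangle_free K2.
Proof.
by apply/forallP => -[]; apply/forallP => -[]; apply/forallP => -[].
Qed.

Lemma card_K2 : #|K2| = 2.
Proof. exact: card_bool. Qed.

Lemma mu_i_K2 : mu_i K2 = 1.
Proof.
apply/eqP; rewrite eqn_leq; apply/andP; split.
  apply/bigmax_leqP => X /imvP[indX _]; apply/card_le1_eqP => x y Xx Xy.
  by apply/eqP; apply: negbNE (indX y x Xy Xx).
by rewrite -(cards1 (true : K2)); apply: leq_bigmax_cond (imv_set1 _).
Qed.

(* [uphalf m] is the ceiling of m / 2; the truncated subtraction is exact
   by mu_i_le_order. *)
Theorem theorem4p1 :
  (forall G : sgraph,
     connected G -> triangle_free G -> 2 <= #|G| ->
     chi_mu_i G <= uphalf (#|G| - mu_i G) + 1) /\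
  (exists G : sgraph,
     [/\ connected G, triangle_free G, 2 <= #|G| &
         chi_mu_i G = uphalf (#|G| - mu_i G) + 1]).
Proof.
split; first exact: chi_mu_i_upper.
exists K2; split; rewrite ?card_K2 ?mu_i_K2 //.
- exact: K2_connected.
- exact: K2_triangle_free.
(* Here the bound is [uphalf 1 + 1], that is 2, while two vertices in classes of size at most 1
   require two classes. *)
have := chi_mu_i_upper K2_connected K2_triangle_free.
have := order_le_chi_mu_i K2; rewrite card_K2 mu_i_K2 muln1 => ge2 /(_ isT) le2.
by apply/eqP; rewrite eqn_leq le2 ge2.
Qed.
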